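(* For every ideal $\mathcal{I}$ on $\omega$, $\mathfrak{b}_s(\mathrm{Fin},\mathcal{I},\mathcal{I})=\min\{\mathfrak{b},\mathrm{add}^*(\mathcal{I})\}$.
   Context: An ideal on $\omega$ is a family $\mathcal{I}\subseteq\mathcal{P}(\omega)$ closed under finite unions and subsets, containing all finite sets, with $\omega\notin\mathcal{I}$; $\mathrm{Fin}$ is the ideal of finite sets. $\mathfrak{b}$ is the bounding number. $\mathrm{add}^*(\mathcal{I})=\min\{|\mathcal{F}|:\mathcal{F}\subseteq\mathcal{I}\text{ and }\forall A\in\mathcal{I}\ \exists F\in\mathcal{F}\ (F\setminus A\text{ infinite})\}$, with the convention $\min\emptyset=\mathfrak{c}^+$. For an ideal $\mathcal{K}$, $\widehat{\mathcal{P}}_{\mathcal{K}}$ is the family of sequences $\langle A_n\rangle$ of pairwise disjoint members of $\mathcal{K}$, and $\mathcal{P}_{\mathcal{K}}$ those with union $\omega$. $\mathfrak{b}_s(\mathcal{I},\mathcal{J},\mathcal{K})=\min\{|\mathcal{E}|:\mathcal{E}\subseteq\widehat{\mathcal{P}}_{\mathcal{K}},\ \forall\langle A_n\rangle\in\mathcal{P}_{\mathcal{J}}\ \exists\langle E_n\rangle\in\mathcal{E}\ \bigcup_n(A_{n+1}\cap\bigcup_{i\le n}E_i)\notin\mathcal{I}\}$. *)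

(* Defs.v *)
From mathcomp Require Import all_boot.
From mathcomp Require Import boolp classical_sets functions cardinality.

Set Implicit Arguments.
Unset Strict Implicit.
Unset Printing Implicit Defensive.

Local Open Scope classical_set_scope.
Local Open Scope card_scope.

(** Cardinal numbers are represented by types, via the coercion of sets to
    their subtypes; two of them are the same cardinal when they are in
    bijection ([#=]), and are ordered by [#<=]. *)

Definition least_sets (T : Type) (S : set (set T)) : set (set T) :=
  [set E | S E /\ forall F, S F -> E #<= F].

Lemma least_sets_nonempty (T : Type) (S : set (set T)) :
  S !=set0 -> least_sets S !=set0.
Proof.
move=> [E0 SE0].
pose P (D : set (set T -> T)) := forall F, S F ->
  (forall g, D g -> F (g F)) /\
  (forall g h, D g -> D h -> g F = h F -> g = h).
have [|D [PD Dmax]] := @Zorn_bigcup _ P.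
  move=> C CP totC F SF; split=> [g [X CX Xg]|g h [X CX Xg] [Y CY Yh]].
    exact: (CP X CX F SF).1.
  have [XY|YX] := totC X Y CX CY.
    by apply: (CP Y CY F SF).2 => //; exact: XY.
  by apply: (CP X CX F SF).2 => //; exact: YX.
have [[E [SE surE]]|noE] := pselect (exists E, S E /\
    forall x, E x -> exists2 g, D g & g E = x).
  exists E; split=> // F SF; apply: (@card_le_trans _ _ _ D).
    have -> : E = (fun g => g E) @` D.
      apply/seteqP; split=> [x /surE [g Dg <-]|x [g Dg <-]]; first by exists g.
      exact: (PD E SE).1.
    exact: card_image_le.
  have injF : {in D &, injective (fun g : set T -> T => g F)}.
    by move=> g h /set_mem Dg /set_mem Dh; exact: (PD F SF).2.
  rewrite -(card_le_eql (inj_card_eq injF)).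
  by apply: subset_card_le => _ [g Dg <-]; exact: (PD F SF).1.
have miss F : S F -> exists x, F x /\ forall g, D g -> g F <> x.
  move=> SF; apply: contrapT => H; apply: noE; exists F; split=> // x Fx.
  apply: contrapT => K; apply: H; exists x; split=> // g Dg gx.
  by apply: K; exists g.
have [x0 _] := miss E0 SE0.
have /choice[k kP] : forall F, exists x,
    S F -> F x /\ forall g, D g -> g F <> x.
  move=> F; have [/miss[x xP]|nSF] := pselect (S F); first by exists x.
  by exists x0.
have [] := Dmax (D `|` [set k]).
  split; last by move=> /(_ k (or_intror erefl)) Dk; exact: (kP E0 SE0).2 Dk _.
  by move=> g; left.
move=> F SF; have [Fk nk] := kP F SF; have [DF Dinj] := PD F SF.
split=> [g [/DF//|->//]|g h [Dg|->] [Dh|->] // gh].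
- exact: Dinj.
- by case: (nk g Dg).
- by case: (nk h Dh).
Qed.

(* min {|E| : E in S}, meaningful for nonempty S. *)
Definition least_card (T : Type) (S : set (set T)) : Type :=
  (xget set0 (least_sets S) : set T).

(* K^+ <= 2^K, so the successor is realized by a family of subsets of K. *)
Definition succ_card (K : Type) : Type :=
  least_card [set C : set (set K) | ~ (C #<= [set: K])].

(* min {|E| : E in S}, with the convention that the minimum of the empty family
   is the successor of the continuum. *)
Definition min_card (T : Type) (S : set (set T)) : Type :=
  if pselect (S !=set0) then least_card S else succ_card (set nat).

Definition minc (K L : Type) : Type :=
  if [set: K] #<= [set: L] then K else L.

Record is_ideal (I : set (set nat)) : Prop := IsIdeal {
  ideal_setU : forall A B, I A -> I B -> I (A `|` B);
  ideal_subset : forall A B, A `<=` B -> I B -> I A;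
  ideal_finite : forall A, finite_set A -> I A;
  ideal_setT : ~ I [set: nat] }.

Definition Fin : set (set nat) := [set A | finite_set A].

Definition le_star (f g : nat -> nat) : Prop :=
  finite_set [set n | (g n < f n)%N].

Definition bounding_number : Type :=
  min_card [set F : set (nat -> nat) |
    forall g, exists2 f, F f & ~ le_star f g].

Definition add_star (I : set (set nat)) : Type :=
  min_card [set F : set (set nat) | F `<=` I /\
    forall A, I A -> exists2 B, F B & infinite_set (B `\` A)].

Definition Phat (K : set (set nat)) : set (nat -> set nat) :=
  [set A | (forall n, K (A n)) /\ trivIset [set: nat] A].

Definition Ppart (K : set (set nat)) : set (nat -> set nat) :=
  [set A | Phat K A /\ \bigcup_n A n = [set: nat]].

Definition b_s (I J K : set (set nat)) : Type :=
  min_card [set E : set (nat -> set nat) | E `<=` Phat K /\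
    forall A, Ppart J A -> exists2 e, E e &
      ~ I (\bigcup_n (A n.+1 `&` \bigcup_(i < n.+1) e i))].

(* Main.v *)
Require Import Defs.
From mathcomp Require Import all_boot.
From mathcomp Require Import boolp classical_sets functions cardinality.

Local Open Scope classical_set_scope.
Local Open Scope card_scope.

(** Read a pairwise disjoint sequence [e] of members of [I] as a partial function
    with fibres in [I], and a partition as a total function [h].  The set tested
    in the definition of b_s is then [{k | e(k) < h(k)}], so b_s is the least
    size of a family of partial functions with fibres in [I] admitting no total
    such [h] with [h <=* e] for all members [e].

    Upper bounds: an unbounded family of functions [f] is sent to the
    pseudo-inverses [k |-> min {n | k <= f n + n}]; a witness [B] of add* is sent
    to the function that is 0 exactly on [B].

    Lower bound: a witness of b_s cannot be finite (take minima).  If it is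
    smaller than add*, some [A] in [I] almost contains every fibre of every [e] in
    the family; if it is also smaller than b, the functions bounding the finite
    sets [e^-1(n) \ A] are dominated by a single [g], and the function equal to 0
    on [A] and to the pseudo-inverse of [g] off [A] is a lower bound. *)

(** * Cardinals *)

(** Comparability reduces to the existence of a least set: copy [A] and [B] into the disjoint sum
    [T + U] and see which copy is least. *)
Lemma card_le_total {T U : Type} (A : set T) (B : set U) : A #<= B \/ B #<= A.
Proof.
pose S := [set @inl T U @` A; @inr T U @` B].
have injl : A #= (@inl T U @` A) by rewrite card_eq_sym; apply: inj_card_eq => x y _ _ [].
have injr : B #= (@inr T U @` B) by rewrite card_eq_sym; apply: inj_card_eq => x y _ _ [].
have [|E [SE Emin]] := @least_sets_nonempty _ S; first by exists (inl @` A); left.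
rewrite (card_le_eql injl) (card_le_eqr injr) (card_le_eql injr) (card_le_eqr injl).
by case: SE Emin => -> Emin; [left|right]; apply: Emin; [right|left].
Qed.

Lemma not_card_le_set (T : Type) : ~ ([set: set (set T)] #<= [set: set T]).
Proof.
move=> /pcard_injP[f injf].
pose D := [set x : set T | exists2 X : set (set T), f X = x & ~ X x].
have [DD|nDD] := pselect (D (f D)); last by apply: (nDD); exists D.
case: (DD) => X fXD nX; apply: nX.
by have -> : X = D by apply: injf => //; exact: in_setT.
Qed.

Lemma least_cardP (T : Type) (S : set (set T)) : S !=set0 ->
  exists E, [/\ S E, [set: least_card S] #= E & forall F, S F -> E #<= F].
Proof.
move=> /least_sets_nonempty[E0 lE0]; exists (xget set0 (least_sets S)).
have [SE Emin] := xgetPex set0 (ex_intro _ E0 lE0).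
by split=> //; exact: card_setT.
Qed.

Lemma min_cardP (T : Type) (S : set (set T)) : S !=set0 ->
  exists E, [/\ S E, [set: min_card S] #= E & forall F, S F -> E #<= F].
Proof.
by move=> S0; rewrite /min_card; case: pselect => // S0'; exact: least_cardP.
Qed.

Lemma min_card_le (T : Type) (S : set (set T)) (F : set T) :
  S F -> [set: min_card S] #<= F.
Proof.
move=> SF; have [|E [_ /card_le_eql -> +]] := @min_cardP _ S; last exact.
by exists F.
Qed.

(** Serves the case where add* takes its conventional value, the successor of the continuum. *)
Lemma card_le_succ_card (K : Type) : [set: set K] #<= [set: succ_card (set K)].
Proof.
have [|C [nC /card_le_eqr -> _]] :=
  @least_cardP _ [set C : set (set (set K)) | ~ (C #<= [set: set K])].
  by exists setT; exact: not_card_le_set.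
by have [//|] := card_le_total [set: set K] C.
Qed.

Lemma card_le_funnat_set : [set: nat -> nat] #<= [set: set nat].
Proof.
apply/pcard_injP; exists (fun f => range (fun n => pickle (n, f n))).
(* A function is recovered from the set of codes of its graph. *)
move=> f g _ _ fg; apply/funext => n.
have : range (fun n => pickle (n, f n)) (pickle (n, f n)) by exists n.
by rewrite fg => -[m _ /(pcan_inj pickleK)[-> ->]].
Qed.

(** * Ideals and pseudo-inverses *)

Lemma finite_set_nat_bound (A : set nat) : finite_set A ->
  exists m, forall k, A k -> k <= m.
Proof.
move=> /finite_seqP[s ->]; exists (\max_(i <- s) i) => k /= ks.
exact: leq_bigmax_seq.
Qed.

Lemma finite_set_nat_le (A : set nat) (m : nat) :
  (forall k, A k -> k <= m) -> finite_set A.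
Proof.
by move=> Am; apply: (sub_finite_set _ (finite_II m.+1)) => k /Am.
Qed.

Lemma ideal_bigcup_finite (I : set (set nat)) (T : Type) (D : set T)
    (F : T -> set nat) : is_ideal I -> finite_set D ->
  (forall x, D x -> I (F x)) -> I (\bigcup_(x in D) F x).
Proof.
move=> hI /(finite_seqP (T := {classic T}))[s ->]; elim: s => [|x s IHs] IF.
  by apply: (ideal_finite hI); apply: sub_finite_set (finite_set0 nat) => k [].
apply: (ideal_subset hI (B := F x `|` \bigcup_(y in [set` s]) F y)).
  move=> k [y /=]; rewrite in_cons => /orP[/eqP ->|ys] Fyk; first by left.
  by right; exists y.
apply: (ideal_setU hI); first by apply: IF; rewrite /= mem_head.
by apply: IHs => y ys; apply: IF; rewrite /= in_cons [y \in s]ys orbT.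
Qed.

Lemma reach_ex (f : nat -> nat) (k : nat) : exists n, k <= f n + n.
Proof. by exists k; exact: leq_addl. Qed.

(* The summand [n] makes this finite-to-one and total for every [f]. *)
Definition pseudo_inv (f : nat -> nat) (k : nat) : nat := ex_minn (reach_ex f k).

Lemma pseudo_inv_ge (f : nat -> nat) (k : nat) :
  k <= f (pseudo_inv f k) + pseudo_inv f k.
Proof. by rewrite /pseudo_inv; case: ex_minnP. Qed.

Lemma lt_pseudo_inv (f : nat -> nat) (n k : nat) :
  n < pseudo_inv f k -> f n + n < k.
Proof.
rewrite /pseudo_inv; case: ex_minnP => m _ mmin nm; rewrite ltnNge.
by apply/negP => /mmin; rewrite leqNgt nm.
Qed.

Definition fibres (h : nat -> nat) (n : nat) : set nat := [set k | h k = n].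

Lemma finite_fibre_pseudo_inv (f : nat -> nat) (n : nat) :
  finite_set (fibres (pseudo_inv f) n).
Proof.
by apply: (@finite_set_nat_le _ (f n + n)) => k <-; exact: pseudo_inv_ge.
Qed.

Lemma trivIset_fibres (h : nat -> nat) : trivIset setT (fibres h).
Proof. by move=> i j _ _ [k [<- <-]]. Qed.

Lemma fibres_Phat (I : set (set nat)) (h : nat -> nat) :
  (forall n, I (fibres h n)) -> Phat I (fibres h).
Proof. by move=> Ih; split=> //; exact: trivIset_fibres. Qed.

Lemma fibres_Ppart (I : set (set nat)) (h : nat -> nat) :
  (forall n, I (fibres h n)) -> Ppart I (fibres h).
Proof.
by move=> Ih; split; [exact: fibres_Phat|apply/seteqP; split=> // k _; exists (h k)].
Qed.

Lemma Ppart_fibres (I : set (set nat)) (A : nat -> set nat) : Ppart I A ->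
  exists2 h, A = fibres h & forall n, I (fibres h n).
Proof.
move=> [[IA tA] UA].
have /choice[h hP] k : exists n, A n k.
  by have [n _ Ank] : (\bigcup_n A n) k by [rewrite UA]; exists n.
suff Ah : A = fibres h by exists h => // n; rewrite -Ah.
apply/funext => n; apply/seteqP; split=> [k Ank|k <-]; last exact: hP.
by apply: tA => //; exists k; split.
Qed.

(** A point [k] lies only in the fibre of index [h k], so the index [n] of the union must be
    [(h k).-1], which exists as soon as some [i < h k]. *)
Lemma bigcup_fibresE (h : nat -> nat) (e : nat -> set nat) :
  \bigcup_n (fibres h n.+1 `&` \bigcup_(i < n.+1) e i) =
  [set k | exists2 i, e i k & i < h k].
Proof.
apply/seteqP; split=> [k [n _ [hk [i /= ilt eik]]]|k [i eik ilt]].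
  by exists i => //; rewrite hk.
by exists (h k).-1 => //; split; [|exists i => //]; rewrite /fibres /= prednK //;
  exact: leq_ltn_trans ilt.
Qed.

(** * The three numbers *)

Section b_s_bounds.
Context (I : set (set nat)) (hI : is_ideal I).

Let b_witness := [set F : set (nat -> nat) |
  forall g, exists2 f, F f & ~ le_star f g].
Let add_witness := [set F : set (set nat) | F `<=` I /\
  forall A, I A -> exists2 B, F B & infinite_set (B `\` A)].
Let bs_witness := [set E : set (nat -> set nat) | E `<=` Phat I /\
  forall A, Ppart I A -> exists2 e, E e &
    ~ Fin (\bigcup_n (A n.+1 `&` \bigcup_(i < n.+1) e i))].

Lemma b_witness_nonempty : b_witness !=set0.
Proof.
exists setT => g; exists (fun n => (g n).+1) => // /(sub_finite_set (A := setT)) fin.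
by apply: infinite_nat; apply: fin => n _ /=.
Qed.

Lemma b_s_le_b : [set: b_s Fin I I] #<= [set: bounding_number].
Proof.
have [F [bF /card_le_eqr -> _]] := min_cardP _ _ b_witness_nonempty.
apply: card_le_trans (card_image_le (fun f => fibres (pseudo_inv f)) F).
apply: min_card_le; split.
  move=> _ [f _ <-]; apply: fibres_Phat => n.
  exact/(ideal_finite hI)/finite_fibre_pseudo_inv.
move=> A /Ppart_fibres[h -> Ih].
(* [h] is unbounded: otherwise finitely many fibres, all in [I], would cover [nat]. *)
have /choice[g gP] n : exists k, n < h k.
  apply: contrapT => nk; apply: (ideal_setT hI).
  apply: (ideal_subset hI (B := \bigcup_(i in `I_n.+1) fibres h i)).
    move=> k _; exists (h k) => //=; rewrite ltnS leqNgt.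
    by apply/negP => nhk; apply: nk; exists k.
  by apply: (ideal_bigcup_finite _ _ _ _ hI) => //; exact: finite_II.
have [f Ff nfg] := bF g.
exists (fibres (pseudo_inv f)); first by exists f.
rewrite bigcup_fibresE => fin; apply: nfg.
(* [g n < f n] puts [g n] in the tested set, and [n < h (g n)]. *)
have [m mP] := finite_set_nat_bound _ (finite_image h fin).
apply: (@finite_set_nat_le _ m) => n /= gfn.
apply: leq_trans (ltnW (gP n)) (mP _ _); exists (g n) => //=.
exists (pseudo_inv f (g n)) => //; apply: leq_ltn_trans (gP n).
rewrite leqNgt; apply/negP => /lt_pseudo_inv.
by rewrite ltnNge (leq_trans (ltnW gfn)) ?leq_addr.
Qed.

Lemma b_s_le_add_star : add_witness !=set0 ->
  [set: b_s Fin I I] #<= [set: add_star I].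
Proof.
move=> /(min_cardP _ _)[F [[FI addF] /card_le_eqr -> _]].
pose E (B : set nat) (n : nat) := if n is 0 then B else set0.
apply: card_le_trans (card_image_le E F); apply: min_card_le; split.
  move=> _ [B FB <-]; split; last by move=> [|i] [|j] _ _ [k []].
  by case=> [|n] /=; [exact: FI|exact/(ideal_finite hI)/finite_set0].
move=> A /Ppart_fibres[h -> Ih]; have [B FB infB] := addF _ (Ih 0).
exists (E B); first by exists B.
rewrite bigcup_fibresE => fin; apply: infB; apply: sub_finite_set fin => k [Bk hk].
by exists 0 => //; rewrite lt0n; apply/eqP.
Qed.

Lemma bs_witness_infinite (E : set (nat -> set nat)) :
  bs_witness E -> infinite_set E.
Proof.
move=> [EI bsE] finE.
(* The alternative [n = k] makes the minimum total on points that no [e] covers, and adds at most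
   the point [n] to the fibre of index [n]. *)
pose P k n := `[< n = k \/ exists2 e, E e & e n k >].
have exP k : exists n, P k n by exists k; apply/asboolP; left.
pose h k := ex_minn (exP k).
have [|e Ee] := bsE (fibres h).
  apply: fibres_Ppart => n.
  apply: (ideal_subset hI (B := [set n] `|` \bigcup_(e in E) e n)).
    move=> k <-; rewrite /h; case: ex_minnP => m /asboolP[->|[e Ee emk]] _.
      by left.
    by right; exists e.
  apply: (ideal_setU hI); first exact/(ideal_finite hI)/finite_set1.
  by apply: (ideal_bigcup_finite _ _ _ _ hI) => // e /EI[].
apply; rewrite bigcup_fibresE; apply: sub_finite_set (finite_set0 nat).
move=> k [i eik]; rewrite /h; case: ex_minnP => m _ mmin.
by rewrite ltnNge mmin //; apply/asboolP; right; exists e.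
Qed.

Lemma almost_cover (F : set (set nat)) : F `<=` I ->
  ~ ([set: add_star I] #<= F) ->
  exists2 A, I A & forall B, F B -> finite_set (B `\` A).
Proof.
move=> FI nF; apply: contrapT => nA; apply: nF; apply: min_card_le; split=> // A IA.
apply: contrapT => nB; apply: nA; exists A => // B FB.
by apply: contrapT => infB; apply: nB; exists B.
Qed.

Lemma dominated (F : set (nat -> nat)) :
  ~ ([set: bounding_number] #<= F) -> exists g, forall f, F f -> le_star f g.
Proof.
move=> nF; apply: contrapT => nA; apply: nF; apply: min_card_le => g.
apply: contrapT => nf; apply: nA; exists g => f Ff.
by apply: contrapT => nfg; apply: nf; exists f.
Qed.

Lemma b_or_add_star_le (E : set (nat -> set nat)) : bs_witness E ->
  [set: bounding_number] #<= E \/ [set: add_star I] #<= E.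
Proof.
move=> bsE; have infE := bs_witness_infinite _ bsE; case: bsE => EI bsE.
apply: contrapT => /not_orP[nb nadd].
have small F : F #<= E -> ~ ([set: add_star I] #<= F).
  by move=> FE addF; apply: nadd; exact: card_le_trans FE.
(* add* is used twice, first on the countably many fibres of one [e], which [E] outnumbers because
   it is infinite, then on the sets [a e]. This avoids the cardinality of the family of all
   fibres. *)
have /choice[a aP] (e : nat -> set nat) : exists A, E e ->
    I A /\ forall n, finite_set (e n `\` A).
  have [Ee|nEe] := pselect (E e); last by exists set0.
  have [| |A IA AP] := almost_cover (range e).
  - by move=> _ [n _ <-]; case: (EI _ Ee).
  - apply: small; apply: card_le_trans (card_image_le _ _) _.
    exact/infiniteP.
  by exists A => _; split=> // n; apply: AP; exists n.
have [| |A IA AP] := almost_cover (a @` E).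
- by move=> _ [e Ee <-]; case: (aP _ Ee).
- exact/small/card_image_le.
have /choice[b bP] (e : nat -> set nat) : exists f : nat -> nat, E e ->
    forall n k, e n k -> ~ A k -> k <= f n.
  have [Ee|nEe] := pselect (E e); last by exists id.
  suff /choice[f fP] n : exists m, forall k, e n k -> ~ A k -> k <= m by exists f.
  have [|m mP] := finite_set_nat_bound (e n `\` A); last first.
    by exists m => k enk nAk; apply: mP.
  have [_ /(_ n) fin1] := aP _ Ee.
  have fin2 : finite_set (a e `\` A) by apply: AP; exists e.
  apply: (@sub_finite_set _ _ ((e n `\` a e) `|` (a e `\` A))).
    by move=> k [enk nAk]; have [|] := pselect (a e k); [right|left].
  by rewrite finite_setU.
have [|g gP] := dominated (b @` E).
  by move=> bE; apply: nb; exact: card_le_trans bE (card_image_le _ _).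
pose h k := if `[< A k >] then 0 else pseudo_inv g k.
have [|e Ee] := bsE (fibres h).
  apply: fibres_Ppart => n.
  apply: (ideal_subset hI (B := A `|` fibres (pseudo_inv g) n)).
    by move=> k; rewrite /fibres /h /=; case: asboolP; [left|right].
  by apply: (ideal_setU hI) => //; exact/(ideal_finite hI)/finite_fibre_pseudo_inv.
apply; rewrite bigcup_fibresE.
have fin : finite_set [set n | g n < b e n] by apply: gP; exists e.
(* A bad point [k] in [e n] lies off [A], so [g n + n < k <= b e n]: only finitely many [n] occur,
   each with boundedly many [k]. *)
apply: sub_finite_set (bigcup_finite fin (fun n _ => finite_II (b e n).+1)).
move=> k [n enk]; rewrite /h; case: asboolP => // nAk /lt_pseudo_inv gk.
have kb := bP _ Ee _ _ enk nAk; exists n => //=.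
exact: leq_ltn_trans (leq_addr _ _) (leq_trans gk kb).
Qed.

(** Rules out the default value for b_s. Against a partition [h], the shifted sequence takes the
    value [h k - 1] wherever [h k] is nonzero, and the fibre over 0 is not cofinite. *)
Lemma bs_witness_nonempty : bs_witness !=set0.
Proof.
exists (Phat I); split=> // A PA; have [h -> Ih] := Ppart_fibres _ _ PA.
exists (fun n => fibres h n.+1).
  by split=> // i j _ _ [k [hi hj]]; apply: succn_inj; rewrite -hi -hj.
rewrite bigcup_fibresE => fin; apply: (ideal_setT hI).
rewrite -(setUv (fibres h 0)); apply: (ideal_setU hI) => //.
apply: (ideal_finite hI); apply: sub_finite_set fin => k /= hk.
have hk0 : 0 < h k by rewrite lt0n; apply/eqP.
by exists (h k).-1; rewrite /fibres /= prednK.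
Qed.

End b_s_bounds.

Theorem theorem4p8 (I : set (set nat)) (hI : is_ideal I) :
  [set: b_s Fin I I] #= [set: minc bounding_number (add_star I)].
Proof.
have lower : [set: bounding_number] #<= [set: b_s Fin I I] \/
             [set: add_star I] #<= [set: b_s Fin I I].
  have [E [bsE eqE _]] := min_cardP _ _ (bs_witness_nonempty _ hI).
  by rewrite !(card_le_eqr eqE); exact: b_or_add_star_le.
have le_b := b_s_le_b _ hI.
have le_add : [set: b_s Fin I I] #<= [set: add_star I].
  have [/(b_s_le_add_star _ hI)//|noF] := pselect ([set F : set (set nat) |
    F `<=` I /\ forall A, I A -> exists2 B, F B & infinite_set (B `\` A)] !=set0).
  (* With no witness for add*, b_s is at most b, hence at most the continuum and its successor. *)
  rewrite /add_star /min_card; case: pselect => //= noF'.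
  apply: card_le_trans (card_le_succ_card _); apply: card_le_trans le_b _.
  have [F [_ /card_le_eql -> _]] := min_cardP _ _ b_witness_nonempty.
  exact: card_le_trans (card_leT _) card_le_funnat_set.
rewrite /minc; case: ifP => b_add; apply: Cantor_Bernstein => //.
  by case: lower => // add_bs; exact: card_le_trans add_bs.
(* Here b is not below add*, so b below b_s would contradict [le_add]. *)
by case: lower => // b_bs; move: b_add; rewrite (card_le_trans b_bs le_add).
Qed.
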